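(* For every $n\ge 1$, as rational functions of $x$, $$\frac{U_{n-1}(x)}{T_n(x)}=\cfrac{1}{\frac{a_1x-1}{\sqrt{a_1^2-1}}-\cfrac{(x-a_1)^2/(a_1^2-1)}{\frac{a_1x-1}{\sqrt{a_1^2-1}}+\frac{a_2x-1}{\sqrt{a_2^2-1}}-\cfrac{(x-a_2)^2/(a_2^2-1)}{\ddots-\cfrac{(x-a_{n-1})^2/(a_{n-1}^2-1)}{\frac{a_{n-1}x-1}{\sqrt{a_{n-1}^2-1}}+\frac{a_nx-1}{\sqrt{a_n^2-1}}}}}}.$$ (For $n=1$ the right-hand side is $1\big/\frac{a_1x-1}{\sqrt{a_1^2-1}}$.)
   Context: Let $\{a_k\}_{k=1}^\infty$ be a sequence of distinct real numbers with $a_k\notin[-1,1]$. The symbol $\sqrt{x^2-1}$ denotes the branch analytic on $\mathbb{C}\setminus[-1,1]$ with $\sqrt{x^2-1}\sim x$ as $x\to\infty$ (so it is negative for real $x<-1$). Put $c_k=a_k-\sqrt{a_k^2-1}$; then $c_k$ is real, $0<|c_k|<1$ and $a_k=\frac12(c_k+c_k^{-1})$. Define $f_0(z)\equiv 1$ and $f_n(z)=\prod_{k=1}^n\frac{z-c_k}{1-c_kz}$. The Chebyshev rational functions are the rational functions $T_n$, $U_n$ of $x$ determined by $T_n(\cos t)=\operatorname{Re} f_n(e^{it})$ and $U_n(\cos t)=\operatorname{Im} f_{n+1}(e^{it})/\sin t$ for $t\in(0,\pi)$, $n\ge0$. *)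

(* Defs.v *)
From HB Require Import structures.
From mathcomp Require Import all_boot all_order all_algebra complex.
From mathcomp Require Import all_classical all_reals all_analysis.

Set Implicit Arguments.
Unset Strict Implicit.
Unset Printing Implicit Defensive.

Import Order.TTheory GRing.Theory Num.Theory.
Local Open Scope classical_set_scope.
Local Open Scope ring_scope.
Local Open Scope complex_scope.

Notation ratfun R := {fraction {poly R}}.

Section ChebyshevRational.
Variable R : realType.

(* The branch of sqrt(z^2-1) analytic off [-1,1] and asymptotic to z at
   infinity: sqrtc is the principal square root, with cut ]-oo,0], and for
   z != 0 one has 1 - z^-2 in ]-oo,0] iff z in [-1,1].  (The value at 0, on
   the cut, is irrelevant.) *)
Definition sqrt_branch (z : R[i]) : R[i] := z * sqrtc (1 - z ^- 2).

(* Justifies taking the real part in sqrt_a below. *)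
Lemma sqrt_branch_real (x : R) : 1 < `|x| ->
  sqrt_branch x%:C = (Num.sg x * Num.sqrt (x ^+ 2 - 1))%:C.
Proof.
move=> x1; have x0 : x != 0 by rewrite -normr_gt0 (lt_trans ltr01).
have x21 : 1 <= x ^+ 2 by rewrite -real_normK ?num_real// exprn_ege1// ltW.
rewrite /sqrt_branch.
have -> : 1 - x%:C ^- 2 = (1 - x ^- 2)%:C.
  by rewrite rmorphB rmorph1 fmorphV rmorphXn.
have h0 : 0 <= 1 - x ^- 2.
  by rewrite subr_ge0 invf_le1// (lt_le_trans ltr01).
rewrite sqrtc_sqrtr ?lecR// -rmorphM /=; congr (_ %:C).
have -> : x ^+ 2 - 1 = x ^+ 2 * (1 - x ^- 2).
  by rewrite mulrBr mulr1 divff// expf_neq0.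
by rewrite sqrtrM ?sqr_ge0// sqrtr_sqr mulrA -numEsg.
Qed.

(* Sequences (a_k)_{k >= 1} are functions nat -> R; the value a 0 is unused. *)
Implicit Types (a : nat -> R) (k n : nat).

Definition sqrt_a a k : R := complex.Re (sqrt_branch (a k)%:C).

Definition blaschke_zero a k : R := a k - sqrt_a a k.

Definition blaschke a n (z : R[i]) : R[i] :=
  \prod_(1 <= k < n.+1) ((z - (blaschke_zero a k)%:C) / (1 - (blaschke_zero a k)%:C * z)).

Definition expi (t : R) : R[i] := cos t +i* sin t.

(* The rational function F is defined at x, with value y. *)
Definition ratfun_value (F : ratfun R) (x y : R) : Prop :=
  exists p q : {poly R},
    [/\ q.[x] != 0, F = tofrac p / tofrac q & y = p.[x] / q.[x]].

Definition is_chebT a n (F : ratfun R) : Prop :=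
  forall t : R, 0 < t < pi ->
    ratfun_value F (cos t) (complex.Re (blaschke a n (expi t))).

Definition is_chebU a n (F : ratfun R) : Prop :=
  forall t : R, 0 < t < pi ->
    ratfun_value F (cos t) (complex.Im (blaschke a n.+1 (expi t)) / sin t).

(* Definite descriptions: 0 is only a default for when there is no such
   rational function. *)
Definition chebT a n : ratfun R := xget 0 [set F | is_chebT a n F].
Definition chebU a n : ratfun R := xget 0 [set F | is_chebU a n F].

Definition cf_b a k : ratfun R :=
  tofrac ((sqrt_a a k)^-1 *: ((a k) *: 'X - 1)).

Definition cf_partial_num a k : ratfun R :=
  tofrac ((a k ^+ 2 - 1)^-1 *: ('X - (a k)%:P) ^+ 2).

Definition cf_partial_den a k : ratfun R :=
  if k == 1%N then cf_b a 1 else cf_b a k.-1 + cf_b a k.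

(* cf_tail a k m = d_k - e_k / (d_(k+1) - e_(k+1) / (... / d_(k+m))), where
   e_j and d_j are the partial numerators and denominators. *)
Fixpoint cf_tail a k m : ratfun R :=
  if m is m'.+1
  then cf_partial_den a k - cf_partial_num a k / cf_tail a k.+1 m'
  else cf_partial_den a k.

End ChebyshevRational.

(* Main.v *)
Require Import Defs.
From HB Require Import structures.
From mathcomp Require Import all_boot all_order all_algebra complex.
From mathcomp Require Import all_classical all_reals all_analysis.
From mathcomp Require Import ring lra.
Import Order.TTheory GRing.Theory Num.Theory.
Local Open Scope ring_scope.

(** Write s_k for the chosen root of a_k^2 - 1 and c_k = a_k - s_k.  On the unit
circle, with x = cos t and y = sin t, a single Blaschke factor is

   (z - c_k) / (1 - c_k z) = ((a_k x - 1) + i s_k y) / (a_k - x),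

so a product of consecutive factors k, ..., n equals (P + i y Q) / D, where D is
the product of the a_j - x and the polynomials P, Q in x are obtained by
multiplying complex numbers and replacing y^2 by 1 - x^2 ([cheb_poly],
[blaschke_prodE]).  Consequently T_n = P/D and U_(n-1) = Q/D for the full
product, because a rational function is determined by its values on ]-1, 1[
([ratfun_value_inj]); the quotient U_(n-1) / T_n is Q/P.

The continued fraction is the cotangent addition formula, iterated.  The ratio
tau_k = P/Q of the factors k, ..., n plays the part of a cotangent, up to the
factor y, and so does b_k = (a_k x - 1) / s_k for the single factor k.  Hence

   tau_k = (b_k tau_(k+1) - (1 - x^2)) / (b_k + tau_(k+1))
         = b_k - (b_k^2 + 1 - x^2) / (b_k + tau_(k+1)),

and b_k^2 + 1 - x^2 = (x - a_k)^2 / (a_k^2 - 1) is the k-th partial numerator.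
The tail of the continued fraction starting at k + 1 is b_k + tau_(k+1), which
gives tau_k by induction on the length ([cf_restE]); the whole fraction is tau_1.

No denominator vanishes identically, as one sees at x = 1: there P equals D, a
product of the nonzero a_k - 1, and Q/P is the sum of the s_k / (a_k - 1), which
are positive since s_k and a_k - 1 both have the sign of a_k. *)

(** * Rational functions are determined by their values on an interval *)

Section RationalFunctions.
Set Implicit Arguments.
Unset Strict Implicit.
Variable R : realType.

Lemma poly_eq_on_unit_interval (p q : {poly R}) :
  (forall x : R, -1 < x < 1 -> p.[x] = q.[x]) -> p = q.
Proof.
move=> pq; apply/eqP; rewrite -subr_eq0; apply/negP => /negP pq0.
pose pts := [seq (i.+2%:R : R)^-1 | i <- iota 0 (size (p - q))].
have /(max_poly_roots pq0) : all (root (p - q)) pts.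
  apply/allP => _ /mapP[i _ ->]; rewrite rootE hornerD hornerN subr_eq0.
  apply/eqP/pq/andP; split.
    by rewrite (lt_trans (ltrN10 _))// invr_gt0 ltr0n.
  by rewrite invf_lt1 ?ltr0n// ltr1n.
rewrite map_inj_uniq ?iota_uniq; last first.
  by move=> i j /invr_inj/eqP; rewrite eqr_nat => /eqP[].
by rewrite size_map size_iota ltnn => /(_ isT).
Qed.

(** [ratfun_value] lets the representing fraction depend on the point; this
transfers the value to one fixed fraction, in a form free of division because
the denominator of that fraction may vanish at some points. *)
Lemma ratfun_value_horner (p q : {poly R}) (x y : R) : q != 0 ->
  ratfun_value (tofrac p / tofrac q) x y -> y * q.[x] = p.[x].
Proof.
move=> q0 [p' [q' [q'x0 /eqP pq ->]]].
have q'0 : q' != 0 by apply: contraNneq q'x0 => ->; rewrite horner0.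
move: pq; rewrite eqr_div ?tofrac_eq0// -!tofracM tofrac_eq => /eqP pq.
have := congr1 (horner^~ x) pq; rewrite /= !hornerM => pqx.
by apply: (mulIf q'x0); rewrite pqx; field.
Qed.

Lemma ratfun_value_inj (F G : ratfun R) (h : R -> R) :
  (forall t, 0 < t < pi -> ratfun_value F (cos t) (h t)) ->
  (forall t, 0 < t < pi -> ratfun_value G (cos t) (h t)) -> F = G.
Proof.
move=> hF hG.
(* Any point serves to obtain fixed fractions for F and G. *)
have tpi : 0 < (pi / 2 : R) < pi by have := pi_gt0 R; lra.
have [p [q [qx0 Fpq _]]] := hF _ tpi.
have [r [s [sx0 Grs _]]] := hG _ tpi.
have q0 : q != 0 by apply: contraNneq qx0 => ->; rewrite horner0.
have s0 : s != 0 by apply: contraNneq sx0 => ->; rewrite horner0.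
rewrite {}Fpq in hF *; rewrite {}Grs in hG *.
apply/eqP; rewrite eqr_div ?tofrac_eq0// -!tofracM tofrac_eq; apply/eqP.
apply: poly_eq_on_unit_interval => x xI.
have x1 : -1 <= x <= 1 by lra.
have tx : 0 < acos x < pi.
  by rewrite acos_gt0 ?acos_ltpi//; lra.
have := ratfun_value_horner q0 (hF _ tx).
have := ratfun_value_horner s0 (hG _ tx).
by rewrite acosK// !hornerM => <- <-; ring.
Qed.

End RationalFunctions.

(** * Blaschke products on the unit circle *)

Section Blaschke.
Set Implicit Arguments.
Unset Strict Implicit.
Variable R : realType.
Implicit Types (a x : R) (l : seq R).

Definition branch_root a : R := complex.Re (sqrt_branch (a%:C)%C).

Lemma branch_rootE a : 1 < `|a| ->
  branch_root a = Num.sg a * Num.sqrt (a ^+ 2 - 1).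
Proof. by move=> a1; rewrite /branch_root sqrt_branch_real. Qed.

Lemma sqr_gt1 a : 1 < `|a| -> 0 < a ^+ 2 - 1.
Proof. by move=> a1; rewrite subr_gt0 -real_normK ?num_real// exprn_egt1. Qed.

Lemma branch_root_sqr a : 1 < `|a| -> branch_root a ^+ 2 = a ^+ 2 - 1.
Proof.
move=> a1; rewrite branch_rootE// exprMn sqr_sqrtr ?ltW ?sqr_gt1//.
by rewrite sqr_sg -normr_gt0 (lt_trans ltr01)// mul1r.
Qed.

Lemma branch_root_neq0 a : 1 < `|a| -> branch_root a != 0.
Proof. by move=> a1; rewrite -sqrf_eq0 branch_root_sqr// gt_eqF// sqr_gt1. Qed.

(** The branch is odd: its root has the sign of [a], as has [a - 1]. *)
Lemma branch_root_div_gt0 a : 1 < `|a| -> 0 < branch_root a / (a - 1).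
Proof.
move=> a1; rewrite branch_rootE//.
have r0 : 0 < Num.sqrt (a ^+ 2 - 1) by rewrite sqrtr_gt0 sqr_gt1.
have [a0|a0|a0] := sgrP a; last 2 first.
- by rewrite mul1r divr_gt0//; move: a1; rewrite gtr0_norm//; lra.
- by rewrite mulN1r nmulr_rgt0 ?oppr_lt0// invr_lt0; lra.
- by move: a1; rewrite a0 normr0 ltr10.
Qed.

(** The pair (P, Q) such that the product of the numerators
(a x - 1) + i s y over the poles a in [l] is P + i y Q.  Recursing on the first
pole matches the continued fraction, which is unfolded from the outside. *)
Fixpoint cheb_poly l : {poly R} * {poly R} :=
  if l is a :: l' then
    let: (p, q) := cheb_poly l' in
    ((a *: 'X - 1) * p - branch_root a *: ((1 - 'X^2) * q),
     branch_root a *: p + (a *: 'X - 1) * q)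
  else (1, 0).

Notation chebP l := (cheb_poly l).1.
Notation chebQ l := (cheb_poly l).2.

Definition pole_poly l : {poly R} := \prod_(a <- l) (a%:P - 'X).

Lemma chebP_cons a l : chebP (a :: l) =
  (a *: 'X - 1) * chebP l - branch_root a *: ((1 - 'X^2) * chebQ l).
Proof. by rewrite /=; case: cheb_poly. Qed.

Lemma chebQ_cons a l : chebQ (a :: l) =
  branch_root a *: chebP l + (a *: 'X - 1) * chebQ l.
Proof. by rewrite /=; case: cheb_poly. Qed.

Definition outside := all (fun a : R => 1 < `|a|).

(** With c = a - s and s^2 = a^2 - 1 one has 1 + c^2 = 2 a c and
1 - c^2 = 2 c s, so multiplying numerator and denominator by the conjugate of
the denominator turns the factor into the stated form. *)
Lemma blaschke_factorE a t : 1 < `|a| -> 0 < t < pi ->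
  ((expi t - (a - branch_root a)%:C) / (1 - (a - branch_root a)%:C * expi t)
    = ((a * cos t - 1) +i* (branch_root a * sin t)) / (a - cos t)%:C)%C.
Proof.
move=> a1 t0; have y0 : 0 < sin t by rewrite sin_gt0_pi.
have xy := cos2Dsin2 t; have := branch_root_sqr a1.
have ax0 : a - cos t != 0.
  by rewrite subr_eq0; apply: contraTneq a1 => ->; rewrite -leNgt cos_max.
rewrite /expi; move: (cos t) (sin t) (branch_root a) => x y s in xy y0 ax0 * => sa.
apply/eqP; rewrite eqr_div; last 2 first.
(* If 1 - c z = 0, its imaginary part gives c = 0, as y > 0, and 1 = 0. *)
- apply/negP => /eqP[+ /eqP]; rewrite /= !mul0r add0r subr0 addr0 oppr_eq0.
  by rewrite mulf_eq0 (gt_eqF y0) orbF => cx /eqP c0; move: cx; rewrite c0; lra.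
- by apply: contra ax0 => /eqP[->].
(* The two sides agree modulo the equations of s and of the circle. *)
have e1 : s ^+ 2 - (a ^+ 2 - 1) = 0 by rewrite sa subrr.
have e2 : x ^+ 2 + y ^+ 2 - 1 = 0 by rewrite xy subrr.
rewrite eq_complex /=; apply/andP; split; apply/eqP; apply: subr0_eq.
  transitivity (s * (s - a) * (x ^+ 2 + y ^+ 2 - 1)
    + (s ^+ 2 - (a ^+ 2 - 1)) * (1 - x ^+ 2)); first by ring.
  by rewrite e1 e2; ring.
transitivity (- (x * y) * (s ^+ 2 - (a ^+ 2 - 1))); first by ring.
by rewrite e1 mulr0.
Qed.

Lemma pole_poly_cos_neq0 l t : outside l -> (pole_poly l).[cos t] != 0.
Proof.
move=> /allP lo; rewrite horner_prod prodf_seq_neq0; apply/allP => a /lo a1 /=.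
rewrite !hornerE subr_eq0; apply: contraTneq a1 => ->.
by rewrite -leNgt ler_norml cos_geN1 cos_le1.
Qed.

Lemma blaschke_prodE l t : outside l -> 0 < t < pi ->
  (\prod_(a <- l) ((expi t - (a - branch_root a)%:C) / (1 - (a - branch_root a)%:C * expi t))
    = ((chebP l).[cos t] +i* (sin t * (chebQ l).[cos t]))
      / ((pole_poly l).[cos t])%:C)%C.
Proof.
move=> + t0; elim: l => [_|a l IH /andP[a1 lo]].
  by rewrite big_nil /pole_poly big_nil /= !hornerE rmorph1 invr1.
rewrite big_cons IH// blaschke_factorE// mulf_div -rmorphM chebP_cons chebQ_cons.
rewrite /pole_poly big_cons !hornerE; congr (_ / _).
have e : sin t ^+ 2 = 1 - cos t ^+ 2 by rewrite -(cos2Dsin2 t) addrC addKr.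
apply/eqP; rewrite eq_complex /= -e; apply/andP; split; apply/eqP; ring.
Qed.

Lemma divc_real (u v d : R) : ((u +i* v) / d%:C = (u / d) +i* (v / d))%C.
Proof.
rewrite -fmorphV; apply/eqP; rewrite eq_complex /=.
by rewrite !mulr0 subr0 add0r mulrC [X in _ && X]eq_sym mulrC !eqxx.
Qed.

(** At x = 1 the imaginary part of the product disappears, since y = 0. *)
Lemma chebP_at1 l : (chebP l).[1] = \prod_(a <- l) (a - 1).
Proof.
elim: l => [|a l IH]; first by rewrite big_nil /= hornerE.
rewrite big_cons -IH chebP_cons !hornerE /=; ring.
Qed.

Lemma chebP_at1_neq0 l : outside l -> (chebP l).[1] != 0.
Proof.
move=> /allP lo; rewrite chebP_at1 prodf_seq_neq0; apply/allP => a /lo a1 /=.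
by rewrite subr_eq0; apply: contraTneq a1 => ->; rewrite normr1 ltxx.
Qed.

(** Q/P is the tangent of the argument of the product, divided by sin t.  As
t tends to 0 all arguments tend to 0 and tangents become additive, so the limit
is the sum of the contributions s / (a - 1) of the single factors. *)
Lemma chebQ_at1 l : outside l ->
  (chebQ l).[1] / (chebP l).[1] = \sum_(a <- l) branch_root a / (a - 1).
Proof.
elim: l => [_|a l IH /[dup] al0 /andP[a1 lo]].
  by rewrite big_nil /= horner0 mul0r.
rewrite big_cons -IH// chebQ_cons.
have := chebP_at1_neq0 al0; rewrite !chebP_at1 big_cons mulf_eq0 negb_or.
by move=> /andP[h1 h2]; rewrite !hornerE chebP_at1; field; rewrite ?h1 ?h2.
Qed.

Lemma chebP_neq0 l : outside l -> chebP l != 0.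
Proof.
by move=> /chebP_at1_neq0; apply: contraNneq => ->; rewrite horner0.
Qed.

(** By [chebQ_at1] the value at 1 is a nonempty sum of positive terms, up to a
nonzero factor. *)
Lemma chebQ_neq0 a l : outside (a :: l) -> chebQ (a :: l) != 0.
Proof.
move=> alo; have /andP[a1 /allP lo] := alo; apply/eqP => Q0.
have := chebQ_at1 alo; rewrite Q0 horner0 mul0r => /esym/eqP; apply/negP.
rewrite big_cons gt_eqF//.
rewrite ltr_wpDr ?branch_root_div_gt0// big_seq sumr_ge0// => b /lo b1.
by rewrite ltW// branch_root_div_gt0.
Qed.

Lemma pole_poly_neq0 l : outside l -> pole_poly l != 0.
Proof.
move=> /(pole_poly_cos_neq0 0); apply: contraNneq => ->.
by rewrite horner0.
Qed.

End Blaschke.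

Notation chebP l := (cheb_poly l).1.
Notation chebQ l := (cheb_poly l).2.

(** * The Chebyshev rational functions and the continued fraction *)

Section Identification.
Set Implicit Arguments.
Unset Strict Implicit.
Variables (R : realType) (a : nat -> R).

Definition poles k n := [seq a i | i <- iota k n].

Hypothesis a_outside : forall k, (0 < k)%N -> 1 < `|a k|.

Lemma outside_poles k n : (0 < k)%N -> outside (poles k n).
Proof.
move=> k0; apply/allP => _ /mapP[i + ->]; rewrite mem_iota => /andP[ki _].
exact/a_outside/(leq_trans k0).
Qed.

Lemma tofrac_branch_root_neq0 k : (0 < k)%N ->
  tofrac (branch_root (a k))%:P != 0.
Proof.
by move=> k0; rewrite tofrac_eq0 polyC_eq0 branch_root_neq0// a_outside.
Qed.

Lemma tofrac_chebQ_neq0 k n : (0 < k)%N ->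
  tofrac (chebQ (poles k n.+1)) != 0.
Proof.
move=> k0; rewrite tofrac_eq0.
exact/(@chebQ_neq0 _ (a k) (poles k.+1 n))/(@outside_poles k n.+1).
Qed.

Lemma tofrac_chebP_poles k n :
  tofrac (chebP (poles k n.+1)) =
    tofrac (a k *: 'X - 1) * tofrac (chebP (poles k.+1 n))
    - tofrac (branch_root (a k))%:P
      * (tofrac (1 - 'X^2) * tofrac (chebQ (poles k.+1 n))).
Proof.
rewrite -!tofracM -tofracB; congr tofrac.
by rewrite mul_polyC; exact: chebP_cons.
Qed.

Lemma tofrac_chebQ_poles k n :
  tofrac (chebQ (poles k n.+1)) =
    tofrac (branch_root (a k))%:P * tofrac (chebP (poles k.+1 n))
    + tofrac (a k *: 'X - 1) * tofrac (chebQ (poles k.+1 n)).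
Proof.
rewrite -!tofracM -tofracD; congr tofrac.
by rewrite mul_polyC; exact: chebQ_cons.
Qed.

Lemma blaschkeE n t : 0 < t < pi ->
  (blaschke a n (expi t) =
   ((chebP (poles 1 n)).[cos t] / (pole_poly (poles 1 n)).[cos t])
   +i* (sin t * (chebQ (poles 1 n)).[cos t] / (pole_poly (poles 1 n)).[cos t]))%C.
Proof.
move=> t0; rewrite -divc_real -blaschke_prodE ?outside_poles//.
by rewrite /blaschke big_map /index_iota subn1.
Qed.

Lemma chebTE n :
  chebT a n = tofrac (chebP (poles 1 n)) / tofrac (pole_poly (poles 1 n)).
Proof.
set F := RHS.
have FT : is_chebT a n F.
  move=> t t0; exists (chebP (poles 1 n)), (pole_poly (poles 1 n)).
  by split; rewrite ?pole_poly_cos_neq0 ?outside_poles ?blaschkeE.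
by apply: (ratfun_value_inj _ FT); exact: (xgetI 0 FT).
Qed.

Lemma chebUE n : chebU a n =
  tofrac (chebQ (poles 1 n.+1)) / tofrac (pole_poly (poles 1 n.+1)).
Proof.
set F := RHS.
have FU : is_chebU a n F.
  move=> t t0; exists (chebQ (poles 1 n.+1)), (pole_poly (poles 1 n.+1)).
  split; rewrite ?pole_poly_cos_neq0 ?outside_poles ?blaschkeE//.
  have y0 : sin t != 0 by rewrite gt_eqF// sin_gt0_pi.
  by rewrite [LHS]/= -[sin t * _ / _]mulrA mulrAC mulfV ?mul1r.
by apply: (ratfun_value_inj _ FU); exact: (xgetI 0 FU).
Qed.

(** [cf_tail] without the summand [cf_b a k.-1] that its leading partial
denominator carries when [k > 1]; it is the quantity computed by the cotangent
addition formula. *)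
Definition cf_rest k m : ratfun R :=
  if m is m'.+1 then cf_b a k - cf_partial_num a k / cf_tail a k.+1 m'
  else cf_b a k.

Lemma cf_tail1E m : cf_tail a 1 m = cf_rest 1 m.
Proof. by case: m. Qed.

Lemma cf_tailSE k m : (0 < k)%N -> cf_tail a k.+1 m = cf_b a k + cf_rest k.+1 m.
Proof.
by case: k m => // k [|m] _; rewrite /= /cf_partial_den//= addrA.
Qed.

Lemma cf_bE k : (0 < k)%N ->
  cf_b a k = tofrac (a k *: 'X - 1) / tofrac (branch_root (a k))%:P.
Proof.
move=> k0; have s0 := tofrac_branch_root_neq0 k0.
apply: (mulIf s0); rewrite divfK// /cf_b -tofracM; congr tofrac.
by rewrite mulrC mul_polyC scalerA mulfV ?scale1r ?branch_root_neq0 ?a_outside.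
Qed.

(** The identity (a x - 1)^2 + (a^2 - 1) (1 - x^2) = (x - a)^2, which for
x = cos t says that the Blaschke factor has modulus one at exp(i t). *)
Lemma cf_partial_numE k : (0 < k)%N -> cf_partial_num a k =
  (tofrac (a k *: 'X - 1) ^+ 2
     + tofrac (branch_root (a k))%:P ^+ 2 * tofrac (1 - 'X^2))
   / tofrac (branch_root (a k))%:P ^+ 2.
Proof.
move=> k0; have s0 := branch_root_neq0 (a_outside k0).
have h := expf_neq0 2 (tofrac_branch_root_neq0 k0).
apply: (mulIf h); rewrite divfK// /cf_partial_num -!tofracXn -!tofracM -tofracD.
congr tofrac; rewrite -polyC_exp -(branch_root_sqr (a_outside k0)).
rewrite mulrC mul_polyC scalerA mulfV ?expf_neq0// scale1r.
rewrite branch_root_sqr ?a_outside// -!mul_polyC polyCB polyC_exp; ring.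
Qed.

Lemma div_common_den (F : fieldType) (p q d : F) : d != 0 ->
  q / d / (p / d) = 1 / (p / q).
Proof. by move=> d0; rewrite div1r !invf_div mulrA divfK. Qed.

(** Here and in [cf_step], A / S is the cotangent-like ratio of one factor and
p / q that of the factors after it, with Y = 1 - x^2 in the latter; the two ratios
add up to a ratio whose numerator is the imaginary part S p + A q of the product,
which is the denominator in [cf_step]. *)
Lemma cf_add (F : fieldType) (A S p q : F) : S != 0 -> q != 0 ->
  A / S + p / q = (S * p + A * q) / (S * q).
Proof. by move=> S0 q0; field; rewrite S0 q0. Qed.

Lemma cf_step (F : fieldType) (A S Y p q : F) : S != 0 -> q != 0 ->
  S * p + A * q != 0 ->
  A / S - (A ^+ 2 + S ^+ 2 * Y) / S ^+ 2 / (A / S + p / q)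
    = (A * p - S * (Y * q)) / (S * p + A * q).
Proof. by move=> S0 q0 d0; field; rewrite d0 S0 q0. Qed.

(** The cotangent addition formula, iterated from the innermost factor. *)
Lemma cf_restE k m : (0 < k)%N ->
  cf_rest k m = tofrac (chebP (poles k m.+1)) / tofrac (chebQ (poles k m.+1)).
Proof.
elim: m k => [|m IH] k k0.
  rewrite [LHS]/= cf_bE// (tofrac_chebQ_poles k) (tofrac_chebP_poles k).
  by rewrite [poles _ _]/= [_.1]/= [_.2]/= tofrac1 tofrac0 !mulr1 !mulr0 subr0 addr0.
have Q0 := tofrac_chebQ_neq0 m.+1 k0.
rewrite [LHS]/= cf_tailSE// IH// cf_bE// cf_partial_numE//.
have s0 := tofrac_branch_root_neq0 k0.
have q0 := @tofrac_chebQ_neq0 k.+1 m isT.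
move: Q0; rewrite (tofrac_chebQ_poles k) (tofrac_chebP_poles k) => Q0.
exact: (cf_step (tofrac (1 - 'X^2)) s0 q0 Q0).
Qed.

(** The tail is cf_b a k + tau_(k+1); this form shows that it is nonzero, as
no Q of a nonempty product vanishes. *)
Lemma cf_tail_chebQ k m : (0 < k)%N ->
  cf_tail a k.+1 m = tofrac (chebQ (poles k m.+2))
    / (tofrac (branch_root (a k))%:P * tofrac (chebQ (poles k.+1 m.+1))).
Proof.
move=> k0; rewrite cf_tailSE// cf_restE// cf_bE// (tofrac_chebQ_poles k).
have s0 := tofrac_branch_root_neq0 k0.
have q0 := @tofrac_chebQ_neq0 k.+1 m isT.
exact: (cf_add _ _ s0 q0).
Qed.

(** The whole fraction, at k = 1, has no summand cf_b in front and is P/Q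
itself, whence the separate case. *)
Lemma cf_tail_neq0 k m : (0 < k)%N -> cf_tail a k m != 0.
Proof.
case: k => // -[_|k _].
  rewrite cf_tail1E cf_restE// mulf_neq0 ?invr_eq0 ?tofrac_chebQ_neq0//.
  by rewrite tofrac_eq0 chebP_neq0 ?outside_poles.
rewrite cf_tail_chebQ// mulf_neq0 ?tofrac_chebQ_neq0// invr_eq0.
by rewrite mulf_neq0 ?tofrac_chebQ_neq0 ?tofrac_branch_root_neq0.
Qed.

End Identification.

Theorem corollary3p3 (R : realType) (a : nat -> R)
    (a_distinct : forall j k : nat,
       (0 < j)%N -> (0 < k)%N -> a j = a k -> j = k)
    (a_notin : forall k : nat, (0 < k)%N -> ~~ (-1 <= a k <= 1))
    (n : nat) (n_ge1 : (1 <= n)%N) :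
  (* no division by the zero rational function occurs on either side *)
  [/\ chebT a n != 0,
      (forall k : nat, (1 <= k <= n)%N -> cf_tail a k (n - k) != 0)
    & chebU a n.-1 / chebT a n = 1 / cf_tail a 1 n.-1].
Proof.
have a_outside k : (0 < k)%N -> 1 < `|a k|.
  by move=> /a_notin; rewrite -ler_norml -ltNge.
have D0 : tofrac (pole_poly (poles a 1 n)) != 0.
  by rewrite tofrac_eq0 pole_poly_neq0// outside_poles.
have P0 : tofrac (chebP (poles a 1 n)) != 0.
  by rewrite tofrac_eq0 chebP_neq0// outside_poles.
split.
- rewrite (chebTE a_outside) mulf_eq0 invr_eq0 negb_or.
  by apply/andP; split; [exact: P0 | exact: D0].
- by move=> k /andP[k0 _]; exact: cf_tail_neq0.
- rewrite (chebTE a_outside) (chebUE a_outside) cf_tail1E.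
  rewrite (cf_restE a_outside) ?prednK//.
  exact: (div_common_den _ _ D0).
Qed.
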